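(* Suppose the initial inputs to the scalar Kalman filter and to the SPEnKF are identical, i.e. $\tilde x_0=x_0$ and $\tilde p_0=p_0$. Then for every step $i\ge 0$, as the ensemble size tends to infinity ($\alpha=N/2\to\infty$), the expected value and the variance of the discrepancy $\Delta p_i=\hat p^{\mathrm a}_i-p^{\mathrm a}_i$ in the analysis variance tend to zero: $$\lim_{\alpha\to\infty}\mathbb{E}[\Delta p_i]=0,\qquad \lim_{\alpha\to\infty}\left(\mathbb{E}[\Delta p_i^2]-\mathbb{E}[\Delta p_i]^2\right)=0 .$$
   Context: Let $m_0,m_1,\dots$ be nonzero reals, $r>0$, $p_0,\tilde p_0>0$, $x_0,\tilde x_0\in\mathbb{R}$, and let $y_0,y_1,\dots$ be real observations. Scalar Kalman filter: $x^{\mathrm f}_0=x_0$, $p^{\mathrm f}_0=p_0$, and for $i\ge0$: $k_i=\frac{p^{\mathrm f}_i}{p^{\mathrm f}_i+r}$, $x^{\mathrm a}_i=x^{\mathrm f}_i+k_i(y_i-x^{\mathrm f}_i)$, $p^{\mathrm a}_i=(1-k_i)p^{\mathrm f}_i$, $x^{\mathrm f}_{i+1}=m_ix^{\mathrm a}_i$, $p^{\mathrm f}_{i+1}=m_i^2p^{\mathrm a}_i$. SPEnKF (Scalar Pedagogical Ensemble Kalman Filter) with ensemble size $N>1$ and initial inputs $\tilde x_0,\tilde p_0$: $\hat x^{\mathrm f}_0=\tilde x_0$; the initial anomaly vector $\mathbf a^{\mathrm f}_0\in\mathbb{R}^N$ has i.i.d. $\mathcal N(0,\tilde p_0)$ entries;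 and for $i\ge0$: $\hat p^{\mathrm f}_i=\frac1N(\mathbf a^{\mathrm f}_i\cdot\mathbf a^{\mathrm f}_i)$, $\hat k_i=\frac{\hat p^{\mathrm f}_i}{\hat p^{\mathrm f}_i+r}$, $\hat p^{\mathrm a}_i=(1-\hat k_i)\hat p^{\mathrm f}_i$, $\mathbf a^{\mathrm a}_i=(\hat p^{\mathrm a}_i)^{1/2}(\hat p^{\mathrm f}_i)^{-1/2}\mathbf a^{\mathrm f}_i$, $\hat x^{\mathrm a}_i=\hat x^{\mathrm f}_i+\hat k_i(y_i-\hat x^{\mathrm f}_i)$, $\hat x^{\mathrm f}_{i+1}=m_i\hat x^{\mathrm a}_i$, $\mathbf a^{\mathrm f}_{i+1}=m_i\mathbf a^{\mathrm a}_i$. Thus the initial sample variance $\hat p^{\mathrm f}_0$ is distributed as $\Gamma(\alpha,\alpha/\tilde p_0)$ (shape, rate) with $\alpha=N/2$. Expectations are over the random initial anomalies, with the observations held fixed. *)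

(* Defs.v *)
From HB Require Import structures.
From mathcomp Require Import all_boot all_order all_algebra.
From mathcomp Require Import all_classical all_reals all_analysis.

Set Implicit Arguments.
Unset Strict Implicit.
Unset Printing Implicit Defensive.

Import Order.TTheory GRing.Theory Num.Theory.
Import numFieldNormedType.Exports.

Local Open Scope classical_set_scope.
Local Open Scope ring_scope.

Section ScalarKalmanFilter.
Variables (R : realType) (m : nat -> R) (r : R) (y : nat -> R).

Definition kalman_gain (p : R) : R := p / (p + r).

(* States are pairs (state estimate, error variance). *)
Definition kf_analyze (yi : R) (s : R * R) : R * R :=
  let: (xf, pf) := s in
  let k := kalman_gain pf in
  (xf + k * (yi - xf), (1 - k) * pf).

Definition kf_propagate (mi : R) (s : R * R) : R * R :=
  let: (xa, pa) := s in (mi * xa, mi ^+ 2 * pa).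

(* (x^f_i, p^f_i) *)
Fixpoint kf_forecast (x0 p0 : R) (i : nat) : R * R :=
  if i is j.+1 then
    kf_propagate (m j) (kf_analyze (y j) (kf_forecast x0 p0 j))
  else (x0, p0).

(* (x^a_i, p^a_i) *)
Definition kf_analysis (x0 p0 : R) (i : nat) : R * R :=
  kf_analyze (y i) (kf_forecast x0 p0 i).

Section SPEnKF.
Variable N : nat.

(* The normalization is 1/N, not 1/(N-1): the anomalies are centred at a
   known mean 0. *)
Definition sample_variance (a : 'rV[R]_N) : R :=
  N%:R^-1 * \sum_(j < N) a 0 j * a 0 j.

Definition analysis_variance (pf : R) : R := (1 - kalman_gain pf) * pf.

(* States are pairs (state estimate, anomaly vector).  When the forecast
   sample variance is 0, the quotient below is 0 by the convention 0^-1 = 0;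
   the anomaly vector is then 0 anyway. *)
Definition enkf_analyze (yi : R) (s : R * 'rV[R]_N) : R * 'rV[R]_N :=
  let: (xf, af) := s in
  let pf := sample_variance af in
  let k := kalman_gain pf in
  (xf + k * (yi - xf),
   (Num.sqrt (analysis_variance pf) * (Num.sqrt pf)^-1) *: af).

Definition enkf_propagate (mi : R) (s : R * 'rV[R]_N) : R * 'rV[R]_N :=
  let: (xa, aa) := s in (mi * xa, mi *: aa).

(* (\hat x^f_i, a^f_i), started from the estimate x0 and the anomalies a0 *)
Fixpoint enkf_forecast (x0 : R) (a0 : 'rV[R]_N) (i : nat) : R * 'rV[R]_N :=
  if i is j.+1 then
    enkf_propagate (m j) (enkf_analyze (y j) (enkf_forecast x0 a0 j))
  else (x0, a0).

(* \hat p^f_i *)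
Definition enkf_forecast_variance (x0 : R) (a0 : 'rV[R]_N) (i : nat) : R :=
  sample_variance (enkf_forecast x0 a0 i).2.

(* \hat p^a_i *)
Definition enkf_analysis_variance (x0 : R) (a0 : 'rV[R]_N) (i : nat) : R :=
  analysis_variance (enkf_forecast_variance x0 a0 i).

End SPEnKF.
End ScalarKalmanFilter.

Section GaussianEnsemble.
Context {d : measure_display} {T : measurableType d} {R : realType}.
Variable P : probability T R.

(* Mutual independence: the product rule over every finite subfamily. *)
Definition mutually_independent (I : finType) (X : I -> {RV P >-> R}) : Prop :=
  forall (J : {set I}) (B : I -> set R),
    (forall j, measurable (B j)) ->
    P (\bigcap_(j in [set` J]) (X j @^-1` B j)) =
    (\prod_(j in J) P (X j @^-1` B j))%E.

(* normal_prob takes the standard deviation, whence the square root. *)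
Definition iid_centred_normal (I : finType) (X : I -> {RV P >-> R}) (v : R)
    : Prop :=
  mutually_independent X /\
  forall (j : I) (B : set R), measurable B ->
    distribution P (X j) B = normal_prob 0 (Num.sqrt v) B.

Definition random_vector (N : nat) (X : 'I_N -> {RV P >-> R}) (w : T)
    : 'rV[R]_N := \row_j X j w.

(* w |-> \hat p^a_i - p^a_i.  The filters take separate initial inputs: the
   Kalman filter starts from x0 and p0, the ensemble filter from tx0 and the
   random anomalies X (whose variance is \tilde p_0). *)
Definition variance_discrepancy (m : nat -> R) (r : R) (y : nat -> R)
    (x0 p0 tx0 : R) (N : nat) (X : 'I_N -> {RV P >-> R}) (i : nat) (w : T)
    : R :=
  enkf_analysis_variance m r y tx0 (random_vector X w) i
  - (kf_analysis m r y x0 p0 i).2.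

End GaussianEnsemble.

(* Main.v *)
Require Import Defs.
From HB Require Import structures.
From mathcomp Require Import all_boot all_order all_algebra.
From mathcomp Require Import all_classical all_reals all_analysis.
From mathcomp Require Import measurable_realfun ring lra.
Set Implicit Arguments.
Unset Strict Implicit.
Unset Printing Implicit Defensive.
Import Order.TTheory GRing.Theory Num.Theory.
Import numFieldNormedType.Exports.
Local Open Scope classical_set_scope.
Local Open Scope ring_scope.

(** The analysis variance of the ensemble filter is a deterministic function of
    the initial sample variance [S]: both filters iterate the map
    [p |-> r p / (p + r)] followed by scaling with [m_i ^ 2], and this map is
    1-Lipschitz on the nonnegative reals.  So the discrepancy at step [i] is at
    most [L_i |S - p0|] with [L_i = prod_(j < i) m_j ^ 2].  The squared anomalies
    are pairwise uncorrelated with mean [p0] and a finite second moment, hence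
    [E (S - p0) ^ 2 = O(1 / N)], which bounds the second moment of the
    discrepancy and, with it, its squared mean and its variance. *)

(** * Second and fourth moments of a centred normal law *)

Section NormalMoments.
Context {R : realType}.
Local Notation mu := (@lebesgue_measure R).

(** Change of variables brings in the abstract Radon-Nikodym derivative. It agrees almost everywhere
    with [normal_pdf], since both have the same integral over every measurable set. *)
Lemma ge0_integral_normal_prob (c s : R) (f : R -> \bar R) :
  (forall x, (0 <= f x)%E) -> measurable_fun [set: R] f ->
  (\int[normal_prob c s]_x f x = \int[mu]_x (f x * (normal_pdf c s x)%:E))%E.
Proof.
move=> f0 mf.
have dom := @normal_prob_dominates R c s.
rewrite -(Radon_Nikodym_SigmaFinite.change_of_variables dom f0 measurableT mf).
have mg := measurable_int _ (Radon_Nikodym_SigmaFinite.f_integrable dom).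
have mpdf : measurable_fun [set: R] (fun x => (normal_pdf c s x)%:E).
  by apply/measurable_EFinP; exact: measurable_normal_pdf.
apply: ae_eq_integral => //; [exact: emeasurable_funM..|].
apply: ae_eqe_mul2l; apply: integral_ae_eq => //.
  exact: Radon_Nikodym_SigmaFinite.f_integrable.
by move=> E _ mE; rewrite -Radon_Nikodym_SigmaFinite.f_integral.
Qed.

Lemma measurable_expR_sqr (h : R) :
  measurable_fun [set: R] (fun x => (expR (h * x ^+ 2))%:E).
Proof.
apply/measurable_EFinP; apply: measurableT_comp => //.
by apply: measurable_funM => //; exact: measurable_funX.
Qed.

(* Multiplying the density by the exponential rescales sigma to sigma / q. *)
Lemma normal_expR_sqr (s q : R) : 0 < s -> 0 < q ->
  (\int[normal_prob 0 s]_x (expR ((1 - q ^+ 2) / (s ^+ 2 *+ 2) * x ^+ 2))%:E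
   = q^-1%:E)%E.
Proof.
move=> s0 q0.
rewrite ge0_integral_normal_prob; last 2 first.
- by move=> x; rewrite lee_fin expR_ge0.
- exact: measurable_expR_sqr.
have sn0 : s != 0 by rewrite gt_eqF.
have qn0 : q != 0 by rewrite gt_eqF.
have sq0 : s / q != 0 by rewrite mulf_neq0// invr_eq0.
transitivity (\int[mu]_x (q^-1%:E * (normal_pdf 0 (s / q) x)%:E))%E.
  apply: eq_integral => x _; rewrite !normal_pdfE// -!EFinM; congr EFin.
  have -> : normal_peak (s / q) = q * normal_peak s.
    rewrite /normal_peak expr_div_n.
    have -> : s ^+ 2 / q ^+ 2 * pi *+ 2 = q ^- 2 * (s ^+ 2 * pi *+ 2) by ring.
    rewrite sqrtrM ?invr_ge0 ?sqr_ge0// sqrtrV ?sqr_ge0// sqrtr_sqr gtr0_norm//.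
    by rewrite invfM invrK.
  rewrite /= -[in RHS]mulrA mulKf// mulrCA; congr (_ * _).
  rewrite /normal_fun -expRD; congr expR.
  by rewrite expr_div_n; field; rewrite sn0 qn0.
rewrite ge0_integralZl//=; last 3 first.
- by apply/measurable_EFinP; exact: measurable_normal_pdf.
- by move=> x _; rewrite lee_fin normal_pdf_ge0.
- by rewrite lee_fin invr_ge0 ltW.
by rewrite integral_normal_pdf mule1.
Qed.

(** A constant multiple of exp(h x^2) dominates x^4, and for small enough h > 0 [normal_expR_sqr]
    gives that exponential a finite integral. *)
Lemma normal_moment4_fin (s : R) : 0 < s ->
  (\int[normal_prob 0 s]_x ((x ^+ 4)%:E) \is a fin_num)%E.
Proof.
move=> s0; rewrite ge0_fin_numE; last first.
  by apply: integral_ge0 => x _; rewrite lee_fin exprn_even_ge0.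
(* Any q strictly between 0 and 1 would do: h is then positive and the exponential integrates to 1 /
   q. *)
pose q : R := 2^-1; pose h : R := (1 - q ^+ 2) / (s ^+ 2 *+ 2).
have h0 : 0 < h.
  by rewrite /h /q divr_gt0//; [lra|rewrite pmulrn_lgt0// exprn_gt0].
have mE := measurable_expR_sqr h.
apply: (@le_lt_trans _ _
  (\int[normal_prob 0 s]_x ((4 / h ^+ 2)%:E * (expR (h * x ^+ 2))%:E)))%E.
  apply: ge0_le_integral => //.
  - by move=> x _; rewrite lee_fin exprn_even_ge0.
  - by apply/measurable_EFinP; exact: measurable_funX.
  - exact: measurable_funeM.
  - move=> x _; rewrite -EFinM lee_fin mulrAC ler_pdivlMr ?exprn_gt0//.
    (* With t = h x^2 / 2 >= 0 the claim becomes t^2 <= exp(2 t), the square of t <= exp t. *)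
    have -> : x ^+ 4 * h ^+ 2 = 4 * (h * x ^+ 2 / 2) ^+ 2 by field.
    rewrite ler_pM2l//.
    have t0 : 0 <= h * x ^+ 2 / 2.
      by rewrite divr_ge0// mulr_ge0 ?sqr_ge0// ltW.
    rewrite [in leRHS](_ : h * x ^+ 2 = h * x ^+ 2 / 2 + h * x ^+ 2 / 2); last by field.
    rewrite expRD -expr2 lerXn2r ?nnegrE ?expR_ge0//.
    by apply: le_trans (expR_ge1Dx _); rewrite lerDr.
rewrite ge0_integralZl//=; last by rewrite lee_fin divr_ge0// sqr_ge0.
by rewrite /h normal_expR_sqr ?invr_gt0// -EFinM ltry.
Qed.

Lemma normal_moment2_fin (s : R) : 0 < s ->
  (\int[normal_prob 0 s]_x ((x ^+ 2)%:E) \is a fin_num)%E.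
Proof.
move=> s0; rewrite ge0_fin_numE; last first.
  by apply: integral_ge0 => x _; rewrite lee_fin sqr_ge0.
apply: (@le_lt_trans _ _ (\int[normal_prob 0 s]_x (1 + (x ^+ 4)%:E)))%E.
  apply: ge0_le_integral => //.
  - by move=> x _; rewrite lee_fin sqr_ge0.
  - by apply/measurable_EFinP; exact: measurable_funX.
  - by apply: emeasurable_funD => //; apply/measurable_EFinP; exact: measurable_funX.
  - by move=> x _; rewrite -EFinD lee_fin; nra.
rewrite ge0_integralD//=; last 2 first.
- by move=> x _; rewrite lee_fin exprn_even_ge0.
- by apply/measurable_EFinP; exact: measurable_funX.
rewrite integral_cst//= mul1e probability_setT.
by rewrite lte_add_pinfty ?ltry// ltey_eq normal_moment4_fin.
Qed.

(* Squeezes E X^2 by exp(h x^2) >= 1 + h x^2 with h = (1 - q^2) / (2 s^2), for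
   q on either side of 1; dividing by 1 - q and letting q -> 1 gives s^2. *)
Lemma normal_moment2 (s : R) : 0 < s ->
  (\int[normal_prob 0 s]_x ((x ^+ 2)%:E) = (s ^+ 2)%:E)%E.
Proof.
move=> s0; rewrite -(fineK (normal_moment2_fin s0)); congr EFin.
set e := fine _.
have e0 : 0 <= e.
  by apply: fine_ge0; apply: integral_ge0 => x _; rewrite lee_fin sqr_ge0.
have s20 : 0 < s ^+ 2 *+ 2 by rewrite pmulrn_lgt0// exprn_gt0.
have mX : measurable_fun [set: R] (fun x : R => (x ^+ 2)%:E).
  by apply/measurable_EFinP; exact: measurable_funX.
(* Integrating 1 + h x^2 <= exp(h x^2) gives 1 + h e <= 1 / q; the factor 1 - q of 1 - q^2 then
   cancels. *)
have ub q : 0 < q -> q < 1 -> q * (1 + q) * e <= s ^+ 2 *+ 2.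
  move=> q0 q1; pose h := (1 - q ^+ 2) / (s ^+ 2 *+ 2).
  have h0 : 0 <= h by rewrite divr_ge0 ?(ltW s20)//; nra.
  have : (\int[normal_prob 0 s]_x (1 + h%:E * (x ^+ 2)%:E) <= q^-1%:E)%E.
    rewrite -(normal_expR_sqr s0 q0); apply: ge0_le_integral => //.
    - by move=> x _; rewrite -EFinM -EFinD lee_fin addr_ge0// mulr_ge0// sqr_ge0.
    - by apply: emeasurable_funD => //; exact: measurable_funeM.
    - exact: measurable_expR_sqr.
    - by move=> x _; rewrite -EFinM -EFinD lee_fin; exact: expR_ge1Dx.
  rewrite ge0_integralD//=; last 2 first.
  - by move=> x _; rewrite -EFinM lee_fin mulr_ge0// sqr_ge0.
  - exact: measurable_funeM.
  rewrite integral_cst//= mul1e probability_setT ge0_integralZl//=; last first.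
    by move=> x _; rewrite lee_fin sqr_ge0.
  rewrite -(fineK (normal_moment2_fin s0)) -/e -EFinM -EFinD lee_fin.
  rewrite -div1r ler_pdivlMr//.
  have -> : (1 + h * e) * q = q + (1 - q) * (q * (1 + q) * e / (s ^+ 2 *+ 2)).
    by rewrite /h; field; rewrite gt_eqF.
  move=> H; have {}H : (1 - q) * (q * (1 + q) * e / (s ^+ 2 *+ 2)) <= (1 - q) * 1 by lra.
  by move: H; rewrite ler_pM2l ?subr_gt0// ler_pdivrMr// mul1r.
have lb q : 1 < q -> s ^+ 2 *+ 2 <= q * (1 + q) * e.
  move=> q1; have q0 : 0 < q by lra.
  (* The sign of h is flipped, so that 1 <= exp(- h x^2) + h x^2 has nonnegative terms and
     integrates without any integrability argument. *)
  pose h := (q ^+ 2 - 1) / (s ^+ 2 *+ 2).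
  have h0 : 0 <= h by rewrite divr_ge0 ?(ltW s20)//; nra.
  have : (1 <= \int[normal_prob 0 s]_x
      ((expR ((1 - q ^+ 2) / (s ^+ 2 *+ 2) * x ^+ 2))%:E
       + h%:E * (x ^+ 2)%:E))%E.
    apply: (@le_trans _ _ (\int[normal_prob 0 s]_x 1)%E).
      by rewrite integral_cst//= mul1e probability_setT.
    apply: ge0_le_integral => //.
    - apply: emeasurable_funD; last exact: measurable_funeM.
      exact: measurable_expR_sqr.
    - move=> x _; rewrite -EFinM -EFinD lee_fin.
      rewrite -lerBlDr (_ : 1 - h * x ^+ 2 = 1 + (1 - q ^+ 2) / (s ^+ 2 *+ 2) * x ^+ 2).
        exact: expR_ge1Dx.
      by rewrite /h; field; rewrite gt_eqF.
  rewrite ge0_integralD//=; last 3 first.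
  - exact: measurable_expR_sqr.
  - by move=> x _; rewrite -EFinM lee_fin mulr_ge0// sqr_ge0.
  - exact: measurable_funeM.
  rewrite normal_expR_sqr// ge0_integralZl//=; last first.
    by move=> x _; rewrite lee_fin sqr_ge0.
  rewrite -(fineK (normal_moment2_fin s0)) -/e -EFinM -EFinD lee_fin.
  rewrite -(ler_pM2r q0).
  have -> : (q^-1 + h * e) * q = 1 + (q - 1) * (q * (1 + q) * e / (s ^+ 2 *+ 2)).
    by rewrite /h; field; rewrite !gt_eqF.
  move=> H; have {}H : (q - 1) * 1 <= (q - 1) * (q * (1 + q) * e / (s ^+ 2 *+ 2)) by lra.
  by move: H; rewrite ler_pM2l ?subr_gt0// ler_pdivlMr// mul1r.
apply/eqP; rewrite eq_le; apply/andP; split; rewrite leNgt; apply/negP => lt_e.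
- have e_gt0 : 0 < e by apply: lt_trans lt_e; rewrite exprn_gt0.
  have s_gt0 : 0 < s ^+ 2 by rewrite exprn_gt0.
  (* With 3 t e = e - s^2, the bound [ub] at q = 1 - t reads e + s^2 + t^2 e <= 2 s^2, against s^2 <
     e. *)
  pose t := (e - s ^+ 2) / (3 * e).
  have te : 3 * (t * e) = e - s ^+ 2 by rewrite /t; field; rewrite gt_eqF.
  have t0 : 0 < t by rewrite divr_gt0 ?subr_gt0 ?mulr_gt0.
  have t1 : t < 1 by rewrite ltr_pdivrMr ?mulr_gt0//; lra.
  have := @ub (1 - t); rewrite subr_gt0 => /(_ t1).
  have tte : 0 <= t * (t * e).
    by apply: mulr_ge0; [exact: ltW|apply: mulr_ge0; exact: ltW].
  have -> : (1 - t) * (1 + (1 - t)) * e = 2 * e - 3 * (t * e) + t * (t * e) by ring.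
  by rewrite te; lra.
- have s_gt0 : 0 < s ^+ 2 by rewrite exprn_gt0.
  (* The denominator uses s^2 because e might still be 0. As t^2 e <= t e <= t s^2, the bound [lb]
     at q = 1 + t gives 2 s^2 <= 2 e + 4 t s^2 = e + s^2, against e < s^2. *)
  pose t := (s ^+ 2 - e) / (4 * s ^+ 2).
  have ts : 4 * (t * s ^+ 2) = s ^+ 2 - e by rewrite /t; field; rewrite gt_eqF.
  have t0 : 0 < t by rewrite divr_gt0 ?subr_gt0 ?mulr_gt0.
  have t1 : t < 1 by rewrite ltr_pdivrMr ?mulr_gt0//; lra.
  have := @lb (1 + t); rewrite ltrDl => /(_ t0).
  have te : t * e <= t * s ^+ 2 by rewrite ler_pM2l// ltW.
  have tte : t * (t * e) <= t * e.
    by apply: ler_piMl; [apply: mulr_ge0 => //|]; exact: ltW.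
  have -> : (1 + t) * (1 + (1 + t)) * e = 2 * e + 3 * (t * e) + t * (t * e) by ring.
  by lra.
Qed.

End NormalMoments.

(** * Independence and integration against the law of a random variable *)

Section Independence.
Context d (T : measurableType d) (R : realType) (P : probability T R).

(** The joint law agrees with the product of the marginal laws on rectangles, hence everywhere;
    Tonelli then factors the integral. *)
Lemma ge0_integral_independentM (X Y : {RV P >-> R}) (f g : R -> \bar R) :
  (forall A B, measurable A -> measurable B ->
     P (X @^-1` A `&` Y @^-1` B) = (P (X @^-1` A) * P (Y @^-1` B))%E) ->
  measurable_fun [set: R] f -> measurable_fun [set: R] g ->
  (forall x, (0 <= f x)%E) -> (forall x, (0 <= g x)%E) ->
  (\int[P]_w (f (X w) * g (Y w)) =
   \int[P]_w f (X w) * \int[P]_w g (Y w))%E.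
Proof.
move=> indXY mf mg f0 g0.
have mXY : measurable_fun [set: T] (fun w => (X w, Y w)).
  by apply: measurable_fun_pair; exact: measurable_funPT.
pose XY : {mfun T >-> (R * R)%type} :=
  HB.pack (fun w => (X w, Y w)) (isMeasurableFun.Build _ _ _ _ _ mXY).
pose h (z : R * R) := (f z.1 * g z.2)%E.
have mh : measurable_fun [set: R * R] h.
  by apply: emeasurable_funM; apply: measurableT_comp.
have h0 z : (0 <= h z)%E by rewrite mule_ge0.
rewrite -!(ge0_integral_distribution (P := P))//.
transitivity (\int[P]_w (h \o XY) w)%E; first by [].
rewrite -ge0_integral_distribution//.
rewrite (eq_measure_integral (distribution P X \x distribution P Y)%E); last first.
  move=> A mA _; apply/esym; apply: product_measure_unique => //.
rewrite fubini_tonelli1//= /fubini_F /h /=.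
under eq_integral do rewrite ge0_integralZl//.
by rewrite ge0_integralZr// integral_ge0.
Qed.

Lemma mutually_independent_pair (I : finType) (X : I -> {RV P >-> R}) (j k : I) :
  mutually_independent X -> j != k ->
  forall A B, measurable A -> measurable B ->
    P (X j @^-1` A `&` X k @^-1` B) = (P (X j @^-1` A) * P (X k @^-1` B))%E.
Proof.
move=> indX jk A B mA mB.
(* Independence asks for a measurable set at every index, so [B] is used everywhere away from
   [j]. *)
have := indX [set j; k]%SET (fun i => if i == j then A else B).
rewrite big_setU1 ?inE//= big_set1 eqxx eq_sym (negbTE jk) => <-; last first.
  by move=> i; case: ifP.
congr (P _); apply/seteqP; split => w /=.
  move=> [Aw Bw] i; rewrite /= !inE => /orP[] /eqP ->; first by rewrite eqxx.
  by rewrite eq_sym (negbTE jk).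
move=> H; split.
  by have := H j; rewrite /= !inE eqxx; exact.
by have := H k; rewrite /= !inE eqxx orbT eq_sym (negbTE jk); exact.
Qed.

Lemma integral_normal_law (X : {RV P >-> R}) (v : R) (f : R -> \bar R) :
  (forall B, measurable B ->
     distribution P X B = normal_prob 0 (Num.sqrt v) B) ->
  measurable_fun [set: R] f -> (forall x, (0 <= f x)%E) ->
  (\int[P]_w f (X w) = \int[normal_prob 0 (Num.sqrt v)]_x f x)%E.
Proof.
move=> lawX mf f0; rewrite -(ge0_integral_distribution (P := P))//.
(* Two measurable structures on R are in play: random variables take values in
   the default one, normal_prob is a measure on measurableTypeR. *)
have mid : measurable_fun [set: measurableTypeR R] (idfun : _ -> R).
  by move=> _ A mA; rewrite setTI.
pose idR : {mfun measurableTypeR R >-> R} :=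
  HB.pack (idfun : measurableTypeR R -> R) (isMeasurableFun.Build _ _ _ _ _ mid).
transitivity (\int[distribution (normal_prob 0 (Num.sqrt v)) idR]_x f x)%E.
  by apply: eq_measure_integral => A mA _; exact: lawX.
by rewrite ge0_integral_distribution.
Qed.

(** * Mean and mean square deviation of the sample variance *)

Variables (N : nat) (X : 'I_N -> {RV P >-> R}) (v : R).
Hypotheses (N0 : (0 < N)%N) (v0 : 0 < v) (iidX : iid_centred_normal X v).

Local Notation S := (fun w => sample_variance (random_vector X w)).

Lemma sample_variance_random_vector w :
  sample_variance (random_vector X w) = N%:R^-1 * \sum_(j < N) X j w ^+ 2.
Proof.
by rewrite /sample_variance; congr (_ * _); apply: eq_bigr => j _; rewrite !mxE.
Qed.

Lemma measurable_sample_variance : measurable_fun [set: T] S.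
Proof.
under eq_fun do rewrite sample_variance_random_vector.
apply: measurable_funM => //; apply: measurable_sum => j.
by apply: measurable_funX; exact: measurable_funPT.
Qed.

Let mX2 j : measurable_fun [set: T] (fun w => (X j w ^+ 2)%:E).
Proof. by apply/measurable_EFinP; apply: measurable_funX; exact: measurable_funPT. Qed.

Lemma integral_anomaly_sqr j : (\int[P]_w (X j w ^+ 2)%:E = v%:E)%E.
Proof.
have m2 : measurable_fun [set: R] (fun x : R => (x ^+ 2)%:E).
  by apply/measurable_EFinP; exact: measurable_funX.
rewrite (integral_normal_law (v := v) (f := fun x => (x ^+ 2)%:E))//.
- by rewrite normal_moment2 ?sqrtr_gt0// sqr_sqrtr// ltW.
- exact: (iidX.2 j).
- by move=> x; rewrite lee_fin sqr_ge0.
Qed.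

(** Classically 3 v^2. It is left unevaluated: the O(1 / N) rate only asks for a real number
    independent of [N], and for v > 0 the integral is finite, so [fine] loses nothing. *)
Definition normal_moment4 : R :=
  fine (\int[normal_prob 0 (Num.sqrt v)]_x (x ^+ 4)%:E)%E.

Lemma integral_anomaly_sqrM j k :
  (\int[P]_w (X j w ^+ 2 * X k w ^+ 2)%:E =
   (if j == k then normal_moment4 else v ^+ 2)%:E)%E.
Proof.
have [<-|jk] := eqVneq j k.
  under eq_integral do rewrite -exprD.
  rewrite (integral_normal_law (v := v) (f := fun x => (x ^+ 4)%:E))//.
  - by rewrite fineK// normal_moment4_fin ?sqrtr_gt0.
  - exact: (iidX.2 j).
  - by apply/measurable_EFinP; exact: measurable_funX.
  - by move=> x; rewrite lee_fin exprn_even_ge0.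
have m2 : measurable_fun [set: R] (fun x : R => (x ^+ 2)%:E).
  by apply/measurable_EFinP; exact: measurable_funX.
under eq_integral do rewrite EFinM.
rewrite (ge0_integral_independentM (f := fun x => (x ^+ 2)%:E)
  (g := fun x => (x ^+ 2)%:E))//; last 3 first.
- exact: mutually_independent_pair iidX.1 jk.
- by move=> x; rewrite lee_fin sqr_ge0.
- by move=> x; rewrite lee_fin sqr_ge0.
by rewrite !integral_anomaly_sqr -EFinM expr2.
Qed.

Lemma integral_sample_variance : (\int[P]_w (S w)%:E = v%:E)%E.
Proof.
under eq_integral do rewrite sample_variance_random_vector EFinM -sumEFin.
rewrite ge0_integralZl//; last 2 first.
- by apply: emeasurable_sum => j; exact: mX2.
- by move=> w _; apply: sume_ge0 => j _; rewrite lee_fin sqr_ge0.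
rewrite ge0_integral_sum//; last by move=> j w _; rewrite lee_fin sqr_ge0.
under eq_bigr do rewrite integral_anomaly_sqr.
rewrite sumEFin -EFinM sumr_const card_ord -[v *+ N]mulr_natl mulKf//.
by rewrite pnatr_eq0 -lt0n.
Qed.

(** The squared sum expands into an [N] by [N] array of products; each row has one diagonal entry, a
    fourth moment, and N - 1 uncorrelated entries of mean v^2. *)
Lemma integral_sample_variance_sqr :
  (\int[P]_w (S w ^+ 2)%:E =
   (N%:R^-1 * (normal_moment4 + (N%:R - 1) * v ^+ 2))%:E)%E.
Proof.
have mXX j k : measurable_fun [set: T] (fun w => (X j w ^+ 2 * X k w ^+ 2)%:E).
  by under eq_fun do rewrite EFinM; exact: emeasurable_funM.
have XX0 j k w : (0 <= (X j w ^+ 2 * X k w ^+ 2)%:E)%E.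
  by rewrite lee_fin mulr_ge0 ?sqr_ge0.
under eq_integral => w _.
  rewrite sample_variance_random_vector exprMn [in X in _ * X]expr2 big_distrlr/=.
  rewrite EFinM -sumEFin; under eq_bigr do rewrite -sumEFin; over.
rewrite ge0_integralZl//; last 2 first.
- by do 2 apply: emeasurable_sum => ?; exact: mXX.
- by move=> w _; do 2 apply: sume_ge0 => ? _; exact: XX0.
rewrite ge0_integral_sum//; last 2 first.
- by move=> j; apply: emeasurable_sum => k; exact: mXX.
- by move=> j w _; apply: sume_ge0 => k _; exact: XX0.
have row j : (\int[P]_w (\sum_(k < N) (X j w ^+ 2 * X k w ^+ 2)%:E) =
    (normal_moment4 + (N%:R - 1) * v ^+ 2)%:E)%E.
  rewrite ge0_integral_sum//.
  under eq_bigr do rewrite integral_anomaly_sqrM.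
  rewrite sumEFin (bigD1 j)//= eqxx; congr (_ + _)%:E.
  rewrite (eq_bigr (fun=> v ^+ 2)); last by move=> k kj; rewrite eq_sym (negbTE kj).
  rewrite sumr_const; have -> : #|[pred k | k != j]| = N.-1.
    by rewrite cardC1 card_ord.
  by rewrite -[LHS]mulr_natl -subn1 natrB.
under eq_bigr do rewrite row.
rewrite sumEFin -EFinM sumr_const card_ord -[X in _ * X]mulr_natl; congr EFin.
by rewrite exprVn expr2; field; rewrite pnatr_eq0 -lt0n.
Qed.

(* Stated with nonnegative integrands only, (S - v)^2 + 2 v S = S^2 + v^2 needs
   no integrability argument. *)
Lemma integral_sample_variance_dev :
  (\int[P]_w ((S w - v) ^+ 2)%:E = ((normal_moment4 - v ^+ 2) / N%:R)%:E)%E.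
Proof.
have Nn0 : N%:R != 0 :> R by rewrite pnatr_eq0 -lt0n.
have mS := measurable_sample_variance.
have S0 w : 0 <= S w.
  rewrite sample_variance_random_vector mulr_ge0 ?invr_ge0// sumr_ge0// => j _.
  exact: sqr_ge0.
have eqI : (\int[P]_w ((S w - v) ^+ 2)%:E + (2 * v * v)%:E =
    (N%:R^-1 * (normal_moment4 + (N%:R - 1) * v ^+ 2) + v ^+ 2)%:E)%E.
  rewrite EFinD -integral_sample_variance_sqr.
  transitivity (\int[P]_w (((S w - v) ^+ 2)%:E + (2 * v)%:E * (S w)%:E))%E.
    rewrite ge0_integralD//; last 4 first.
    - by move=> w _; rewrite lee_fin sqr_ge0.
    - by apply/measurable_EFinP; apply: measurable_funX; exact: measurable_funB.
    - move=> w _; rewrite -EFinM lee_fin.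
      by apply: mulr_ge0; [exact: mulr_ge0 (ltW v0)|exact: S0].
    - by apply: measurable_funeM; exact/measurable_EFinP.
    rewrite ge0_integralZl//; last 3 first.
    - exact/measurable_EFinP.
    - by move=> w _; rewrite lee_fin.
    - by rewrite lee_fin mulr_ge0// ltW.
    by rewrite integral_sample_variance -EFinM.
  transitivity (\int[P]_w ((S w ^+ 2)%:E + (v ^+ 2)%:E))%E.
    by apply: eq_integral => w _; rewrite -EFinM -!EFinD; congr EFin; ring.
  rewrite ge0_integralD//; last 3 first.
  - by move=> w _; rewrite lee_fin sqr_ge0.
  - by apply/measurable_EFinP; exact: measurable_funX.
  - by move=> w _; rewrite lee_fin sqr_ge0.
  by rewrite integral_cst//= probability_setT mule1.
rewrite -[LHS](@addeK _ (2 * v * v)%:E)// eqI -EFinB; congr EFin.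
by field.
Qed.

End Independence.

(** * The variance recursion shared by both filters, and its Lipschitz bound *)

Section Filter.
Context {R : realType}.
Variables (m : nat -> R) (r : R) (y : nat -> R).
Hypothesis r0 : 0 < r.

Fixpoint forecast_variance_map (i : nat) (u : R) : R :=
  if i is j.+1 then m j ^+ 2 * analysis_variance r (forecast_variance_map j u)
  else u.

Lemma analysis_variance_ge0 (u : R) : 0 <= u -> 0 <= analysis_variance r u.
Proof.
move=> u0; rewrite /analysis_variance /kalman_gain mulr_ge0// subr_ge0.
by rewrite ler_pdivrMr ?ltr_wpDl// mul1r lerDl ltW.
Qed.

(** The difference factors as u - v times r / (u + r) and r / (v + r), both in [0, 1]. *)
Lemma analysis_variance_dist (u v : R) : 0 <= u -> 0 <= v ->
  `|analysis_variance r u - analysis_variance r v| <= `|u - v|.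
Proof.
move=> u0 v0.
have ur0 : 0 < u + r by rewrite ltr_wpDl.
have vr0 : 0 < v + r by rewrite ltr_wpDl.
have -> : analysis_variance r u - analysis_variance r v =
    (r / (u + r)) * (r / (v + r)) * (u - v).
  by rewrite /analysis_variance /kalman_gain; field; rewrite !gt_eqF.
rewrite normrM ler_piMl//.
have bnd w : 0 <= w -> 0 <= r / (w + r) <= 1.
  move=> w0; have wr0 : 0 < w + r by rewrite ltr_wpDl.
  by rewrite divr_ge0 ?(ltW r0) ?(ltW wr0)//= ler_pdivrMr// mul1r lerDr.
have /andP[a0 a1] := bnd u u0; have /andP[b0 b1] := bnd v v0.
by rewrite ger0_norm; [exact: mulr_ile1|exact: mulr_ge0].
Qed.

Lemma forecast_variance_map_ge0 i (u : R) :
  0 <= u -> 0 <= forecast_variance_map i u.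
Proof.
by move=> u0; elim: i => //= i IH; rewrite mulr_ge0 ?sqr_ge0// analysis_variance_ge0.
Qed.

Lemma forecast_variance_map_dist i (u v : R) : 0 <= u -> 0 <= v ->
  `|forecast_variance_map i u - forecast_variance_map i v| <=
  (\prod_(j < i) m j ^+ 2) * `|u - v|.
Proof.
move=> u0 v0; elim: i => [|i IH]; first by rewrite big_ord0 mul1r.
rewrite /= -mulrBr normrM ger0_norm ?sqr_ge0// big_ord_recr/= -mulrA mulrCA.
rewrite ler_wpM2l ?sqr_ge0//; apply: le_trans IH.
by apply: analysis_variance_dist; exact: forecast_variance_map_ge0.
Qed.

Lemma kf_forecast_variance (x0 p0 : R) i :
  (kf_forecast m r y x0 p0 i).2 = forecast_variance_map i p0.
Proof.
by elim: i => //= i <-; case: (kf_forecast m r y x0 p0 i).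
Qed.

Lemma kf_analysis_varianceE (x0 p0 : R) i :
  (kf_analysis m r y x0 p0 i).2 =
  analysis_variance r (forecast_variance_map i p0).
Proof.
rewrite -(kf_forecast_variance x0) /kf_analysis.
by case: (kf_forecast m r y x0 p0 i).
Qed.

Lemma sample_varianceZ N (c : R) (a : 'rV[R]_N) :
  sample_variance (c *: a) = c ^+ 2 * sample_variance a.
Proof.
rewrite /sample_variance mulrCA; congr (_ * _); rewrite mulr_sumr.
by apply: eq_bigr => j _; rewrite !mxE; ring.
Qed.

Lemma sample_variance_ge0 N (a : 'rV[R]_N) : 0 <= sample_variance a.
Proof.
rewrite /sample_variance mulr_ge0 ?invr_ge0// sumr_ge0// => j _.
by rewrite -expr2 sqr_ge0.
Qed.

Lemma sample_variance_enkf_analyze N (yi : R) (s : R * 'rV[R]_N) :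
  sample_variance (enkf_analyze r yi s).2 =
  analysis_variance r (sample_variance s.2).
Proof.
case: s => xf a /=; rewrite sample_varianceZ.
set p := sample_variance a; have p0 : 0 <= p := sample_variance_ge0 a.
rewrite exprMn exprVn !sqr_sqrtr ?analysis_variance_ge0//.
(* At p = 0 the rescaling quotient is 0 by convention, but the analysis variance of 0 is 0 as
   well. *)
have [->|pn0] := eqVneq p 0; last by rewrite divfK.
by rewrite /analysis_variance !mulr0.
Qed.

Lemma enkf_forecast_varianceE N (x0 : R) (a0 : 'rV[R]_N) i :
  enkf_forecast_variance m r y x0 a0 i =
  forecast_variance_map i (sample_variance a0).
Proof.
rewrite /enkf_forecast_variance; elim: i => //= i IH.
rewrite -IH -(sample_variance_enkf_analyze (y i)).
by case: (enkf_analyze _ _ _) => xa aa /=; rewrite sample_varianceZ.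
Qed.

Let L i := \prod_(j < i) m j ^+ 2.

Let L_ge0 i : 0 <= L i.
Proof. by apply: prodr_ge0 => j _; exact: sqr_ge0. Qed.

(** * Measurability and second moment of the discrepancy *)

Context d (T : measurableType d) (P : probability T R).
Variables (N : nat) (X : 'I_N -> {RV P >-> R}).

Lemma variance_discrepancyE (x0 p0 tx0 : R) i w :
  variance_discrepancy m r y x0 p0 tx0 X i w =
  analysis_variance r
    (forecast_variance_map i (sample_variance (random_vector X w)))
  - analysis_variance r (forecast_variance_map i p0).
Proof.
by rewrite /variance_discrepancy /enkf_analysis_variance enkf_forecast_varianceE
  kf_analysis_varianceE.
Qed.

Lemma variance_discrepancy_le (x0 p0 tx0 : R) i w : 0 <= p0 ->
  variance_discrepancy m r y x0 p0 tx0 X i w ^+ 2 <=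
  L i ^+ 2 * (sample_variance (random_vector X w) - p0) ^+ 2.
Proof.
move=> p00; rewrite variance_discrepancyE -exprMn.
rewrite -[leLHS]real_normK ?num_real// -[leRHS]real_normK ?num_real//.
rewrite lerXn2r ?nnegrE// [leRHS]normrM [X in X * _]ger0_norm//.
have S0 := sample_variance_ge0 (random_vector X w).
apply: le_trans (forecast_variance_map_dist i S0 p00).
by apply: analysis_variance_dist; exact: forecast_variance_map_ge0.
Qed.

(* The map is only well behaved on nonnegative reals; composed with the absolute
   value it is Lipschitz on the whole line, hence continuous. *)
Lemma measurable_variance_discrepancy (x0 p0 tx0 : R) i :
  measurable_fun [set: T] (variance_discrepancy m r y x0 p0 tx0 X i).
Proof.
pose h (u : R) := analysis_variance r (forecast_variance_map i `|u|).
have ch : continuous h.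
  move=> u; apply/cvgrPdist_le => e e0.
  near=> v; apply: (@le_trans _ _ (L i * `|u - v|)).
    apply: le_trans (analysis_variance_dist _ _) _.
    - exact: forecast_variance_map_ge0.
    - exact: forecast_variance_map_ge0.
    apply: le_trans (forecast_variance_map_dist i (normr_ge0 u) (normr_ge0 v)) _.
    by apply: ler_wpM2l; [exact: L_ge0|exact: ler_dist_dist].
  (* [L i] is only known to be nonnegative; adding 1 makes the constant positive, so that [e] can be
     divided by it. *)
  apply: (@le_trans _ _ ((L i + 1) * `|u - v|)).
    by rewrite ler_wpM2r// lerDl.
  rewrite mulrC -ler_pdivlMr ?ltr_wpDl//.
  by near: v; apply: cvgr_dist_le => //; rewrite divr_gt0// ltr_wpDl.
rewrite (_ : variance_discrepancy _ _ _ _ _ _ _ _ = fun w =>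
    h (sample_variance (random_vector X w))
    - analysis_variance r (forecast_variance_map i p0)).
  apply: measurable_funB => //.
  apply: (measurableT_comp (continuous_measurable_fun ch)).
  exact: measurable_sample_variance.
apply/funext => w; rewrite variance_discrepancyE /h.
by rewrite (ger0_norm (sample_variance_ge0 _)).
Unshelve. all: by end_near. Qed.

Lemma expectation_variance_discrepancy_sqr (x0 p0 tx0 : R) i :
  (0 < N)%N -> 0 < p0 -> iid_centred_normal X p0 ->
  ('E_P[(variance_discrepancy m r y x0 p0 tx0 X i ^+ 2)%R] <=
   (L i ^+ 2 * (normal_moment4 p0 - p0 ^+ 2) / N%:R)%:E)%E.
Proof.
move=> N0 p00 iidX; rewrite exprfctE unlock.
have mS := measurable_sample_variance X.
have mD : measurable_fun [set: T]
    (fun w => ((sample_variance (random_vector X w) - p0) ^+ 2)%:E).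
  by apply/measurable_EFinP; apply: measurable_funX; exact: measurable_funB.
rewrite -mulrA EFinM -(integral_sample_variance_dev N0 p00 iidX).
rewrite -ge0_integralZl//; last 2 first.
- by move=> w _; rewrite lee_fin sqr_ge0.
- by rewrite lee_fin sqr_ge0.
apply: ge0_le_integral => //.
- by move=> w _; rewrite lee_fin; exact: sqr_ge0.
- apply/measurable_EFinP; apply: measurable_funX.
  exact: measurable_variance_discrepancy.
- exact: measurable_funeM.
- by move=> w _; rewrite -EFinM lee_fin; apply: variance_discrepancy_le; exact: ltW.
Qed.

End Filter.

(** * Mean and variance controlled by the second moment *)

Section SecondMoment.
Context d (T : measurableType d) (R : realType) (P : probability T R).
Implicit Type X : T -> R.

Lemma Lfun2_sqr_lty X : measurable_fun [set: T] X ->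
  ('E_P[(X ^+ 2)%R] < +oo)%E -> X \in Lfun P 2%:E.
Proof.
move=> mX; rewrite exprfctE expectation.unlock => X2.
rewrite inE; apply/andP; split; rewrite inE//=.
rewrite /finite_norm unlock; apply: poweR_lty.
rewrite [ltLHS](_ : _ = \int[P]_w (X w ^+ 2)%:E)%E//.
by apply: eq_integral => w _ /=; rewrite powR_mulrn// real_normK ?num_real.
Qed.

(** A finite second moment puts X in L^2, hence in L^1 under a probability. Nonnegativity of the
    variance bounds the squared mean by E X^2, and dropping the squared mean bounds the variance by
    E X^2. *)
Lemma expectation_variance_bounds X (b : R) : measurable_fun [set: T] X ->
  ('E_P[(X ^+ 2)%R] <= b%:E)%E ->
  [/\ 'E_P[X]%E \is a fin_num,
      ('E_P[(X ^+ 2)%R] - 'E_P[X] ^+ 2)%E \is a fin_num,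
      fine 'E_P[X]%E ^+ 2 <= b &
      0 <= fine ('E_P[(X ^+ 2)%R] - 'E_P[X] ^+ 2)%E <= b].
Proof.
move=> mX leb.
have L2 : X \in Lfun P 2%:E by rewrite Lfun2_sqr_lty// (le_lt_trans leb)// ltry.
have L1 : X \in Lfun P 1 by rewrite Lfun_subset12// fin_num_measure.
have V0 := variance_ge0 P X.
have Vfin := variance_fin_num L2.
rewrite varianceE// in V0 Vfin.
have EX := expectation_fin_num L1.
have EX2 : 'E_P[(X ^+ 2)%R]%E \is a fin_num.
  rewrite ge0_fin_numE ?(le_lt_trans leb) ?ltry//.
  by apply: expectation_ge0 => w; exact: sqr_ge0.
split => //; move: V0 leb; rewrite -(fineK EX) -(fineK EX2) -EFin_expe -EFinB.
  rewrite !lee_fin subr_ge0; exact: le_trans.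
rewrite !lee_fin /= => -> /= leb.
by apply: le_trans leb; rewrite gerBl sqr_ge0.
Qed.

End SecondMoment.

(** * Passage to the limit in the ensemble size *)

Theorem mainTheorem2 (R : realType)
  (m : nat -> R) (hm : forall i, m i != 0)
  (r : R) (hr : 0 < r)
  (p0 tp0 : R) (hp0 : 0 < p0) (htp0 : 0 < tp0)
  (x0 tx0 : R) (y : nat -> R)
  (d : nat -> measure_display)
  (T : forall N : nat, measurableType (d N))
  (P : forall N : nat, probability (T N) R)
  (a : forall N : nat, 'I_N -> {RV (P N) >-> R})
  (ha : forall N : nat, (1 < N)%N -> iid_centred_normal (a N) tp0)
  (hx : tx0 = x0) (hp : tp0 = p0)
  (i : nat) :
  let Dp (N : nat) : T N -> R :=
    variance_discrepancy m r y x0 p0 tx0 (a N) i in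
  (fun N : nat => 'E_(P N)[Dp N])%E @ \oo --> 0%E /\
  (fun N : nat => 'E_(P N)[(Dp N ^+ 2)%R] - 'E_(P N)[Dp N] ^+ 2)%E
    @ \oo --> 0%E.
Proof.
move=> Dp.
(* The probability space changes with [N], but [C] depends only on the step and on the common normal
   law, so one constant serves all ensembles. *)
pose C := (\prod_(j < i) m j ^+ 2) ^+ 2 * (normal_moment4 p0 - p0 ^+ 2).
have bounds N : (1 < N)%N ->
  [/\ 'E_(P N)[Dp N]%E \is a fin_num,
      ('E_(P N)[(Dp N ^+ 2)%R] - 'E_(P N)[Dp N] ^+ 2)%E \is a fin_num,
      fine 'E_(P N)[Dp N]%E ^+ 2 <= C / N%:R &
      0 <= fine ('E_(P N)[(Dp N ^+ 2)%R] - 'E_(P N)[Dp N] ^+ 2)%E <= C / N%:R].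
  move=> N1; apply: expectation_variance_bounds.
    exact: measurable_variance_discrepancy.
  apply: expectation_variance_discrepancy_sqr => //; first exact: ltnW.
  by rewrite -hp; exact: ha.
have cvgC : (fun N : nat => C / N%:R) @ \oo --> (0 : R).
  rewrite -(mulr0 C); apply: cvgMr; apply/gtr0_cvgV0; last exact: cvgr_idn.
  by near=> N; rewrite ltr0n; near: N; exact: nbhs_infty_gt.
(* Convergence in the extended reals splits into eventual finiteness and convergence of the real
   parts. *)
split; apply/fine_cvgP; split.
- by near=> N; have [] := bounds N; first by near: N; exact: nbhs_infty_gt.
- have sqr0 : (fun N => fine 'E_(P N)[Dp N]%E ^+ 2) @ \oo --> (0 : R).
    apply: (squeeze_cvgr _ (cvg_cst _) cvgC); near=> N.
    by have [|_ _ + _] := bounds N; [near: N; exact: nbhs_infty_gt|rewrite sqr_ge0].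
  (* Only the squared mean has been squeezed; its square root is the absolute mean, and continuity
     of the square root at 0 concludes. *)
  apply: norm_cvg0; rewrite -sqrtr0.
  under eq_fun do rewrite -sqrtr_sqr.
  exact: (cvg_comp _ _ sqr0 (@sqrt_continuous R 0)).
- by near=> N; have [] := bounds N; first by near: N; exact: nbhs_infty_gt.
- apply: (squeeze_cvgr _ (cvg_cst _) cvgC); near=> N.
  by have [|//] := bounds N; near: N; exact: nbhs_infty_gt.
Unshelve. all: by end_near. Qed.
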